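(* Every C-recursive sequence of natural numbers is a Kalmar function.
   Context: Natural numbers are the non-negative integers, and sequences are indexed by $n\ge 0$. A sequence $s(n)$ of natural numbers is C-recursive if there exist an integer $d\ge 1$ and rational numbers $\alpha_1,\dots,\alpha_d$ with $\alpha_d\ne 0$ such that $s(n+d)+\alpha_1 s(n+d-1)+\dots+\alpha_d s(n)=0$ for every integer $n\ge 0$. A (univariate) Kalmar function is a computable sequence of natural numbers $f(n)$ for which there is a fixed $k\ge 0$ such that the deterministic computation time of $f(n)$ on input $n$ is upper-bounded by the iterated exponential $2^{2^{\cdot^{\cdot^{2^n}}}}$ with $k$ twos. *)

(* Defs.v *)
From HB Require Import structures.
From mathcomp Require Import all_boot all_order all_algebra.
Set Implicit Arguments.
Unset Strict Implicit.
Unset Printing Implicit Defensive.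
Import Order.TTheory GRing.Theory Num.Theory.
Local Open Scope ring_scope.

Definition C_recursive (s : nat -> nat) : Prop :=
  exists (d : nat) (alpha : nat -> rat),
    [/\ (1 <= d)%N,
        alpha d != 0 &
        forall n : nat,
          (s (n + d)%N)%:R
          + \sum_(1 <= i < d.+1) alpha i * (s (n + d - i)%N)%:R = 0].

(* Most significant digit first, without leading zeros; 0 is written "0"
   (recall that trunc_log 2 0 = 0). *)
Definition binary (n : nat) : seq bool :=
  [seq odd (n %/ 2 ^ i) | i <- rev (iota 0 (trunc_log 2 n).+1)].

(* A tape symbol is a blank (None), a binary digit (Some (inl b)), or one of
   finitely many auxiliary symbols (Some (inr a)). *)
Definition symbol (A : finType) : finType := option (bool + A)%type.

Variant move := MoveL | Stay | MoveR.

Definition shift (m : move) : int :=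
  match m with MoveL => -1 | Stay => 0 | MoveR => 1 end.

(* Deterministic Turing machine with ntapes.+1 two-way infinite tapes. The
   scanned symbols are passed as a finite function, so that the transition
   function is a finite table. *)
Record turing_machine := TuringMachine {
  aux : finType;
  state : finType;
  ntapes : nat;
  start : state;
  halting : pred state;
  trans_state : state -> {ffun 'I_ntapes.+1 -> symbol aux} -> state;
  trans_write : state -> {ffun 'I_ntapes.+1 -> symbol aux} ->
                'I_ntapes.+1 -> symbol aux;
  trans_move : state -> {ffun 'I_ntapes.+1 -> symbol aux} ->
               'I_ntapes.+1 -> move
}.

Record config (M : turing_machine) := Config {
  cstate : state M;
  ctape : 'I_(ntapes M).+1 -> int -> symbol (aux M);
  chead : 'I_(ntapes M).+1 -> int
}.

(* The tape carrying w on the cells 0, ..., size w - 1, and blank elsewhere. *)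
Definition word_tape (A : finType) (w : seq bool) (p : int) : symbol A :=
  if p is Posz j then nth None [seq Some (inl b) | b <- w] j else None.

Definition init (M : turing_machine) (n : nat) : config M :=
  @Config M (start M)
    (fun i => if i == ord0 then word_tape (aux M) (binary n) else fun=> None)
    (fun=> 0).

(* A configuration whose state is halting is left unchanged. *)
Definition step (M : turing_machine) (c : config M) : config M :=
  if halting (cstate c) then c else
  let r := [ffun i => ctape c i (chead c i)] in
  @Config M (trans_state (cstate c) r)
    (fun i p => if p == chead c i then trans_write (cstate c) r i
                else ctape c i p)
    (fun i => chead c i + shift (trans_move (cstate c) r i)).

(* The output is the word on the last tape (the only one if ntapes = 0), read
   from the head position rightwards up to the first blank. *)
Definition outputs (M : turing_machine) (c : config M) (m : nat) : Prop :=
  forall j : nat, (j <= size (binary m))%N ->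
    ctape c ord_max (chead c ord_max + j%:Z)
    = word_tape (aux M) (binary m) j%:Z.

Definition computes_within (M : turing_machine) (n m T : nat) : Prop :=
  exists t : nat,
    [/\ (t <= T)%N,
        halting (cstate (iter t (@step M) (init M n))) &
        outputs (iter t (@step M) (init M n)) m].

(* 2 ^ (2 ^ ... ^ (2 ^ n)) with k twos. *)
Definition tower (k n : nat) : nat := iter k (expn 2) n.

Definition kalmar (f : nat -> nat) : Prop :=
  exists (k : nat) (M : turing_machine),
    forall n : nat, computes_within M n (f n) (tower k n).

(* Main.v *)
From HB Require Import structures.
From mathcomp Require Import all_boot all_order all_algebra.
From mathcomp Require Import zify ring.
From Stdlib Require Import FunctionalExtensionality.
Require Import Defs.
Set Implicit Arguments.
Unset Strict Implicit.
Unset Printing Implicit Defensive.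
Import Order.TTheory GRing.Theory Num.Theory.
Local Open Scope ring_scope.

(** The time bound is generous enough to compute in unary. After clearing
    denominators, D s(n+d) = c_0 s(n) + ... + c_(d-1) s(n+d-1) with integers
    c_j and D > 0. A tape with a single mark at cell 0 serves as an integer
    register whose value is the head position: it can be incremented,
    decremented and tested for zero. The input is read into a counter by
    Horner's rule; the window s(n), ..., s(n+d-1) is shifted that many times by
    draining registers into each other, and dividing by D is draining the
    accumulator D units at a time; the result is written in binary by repeated
    halving. Since s grows at most exponentially, the running time is bounded
    by a tower of twos. *)

(** * Structured programs and their compilation *)

Definition reads (N : nat) : finType := {ffun 'I_N.+1 -> symbol unit}.

(** Tapes and heads without the control state, so that programs with different state types act on
    the same objects. *)
Definition memory (N : nat) : Type :=
  (('I_N.+1 -> int -> symbol unit) * ('I_N.+1 -> int))%type.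

Definition action (N : nat) : Type :=
  (('I_N.+1 -> symbol unit) * ('I_N.+1 -> move))%type.

Definition scan (N : nat) (c : memory N) : reads N :=
  [ffun i => c.1 i (c.2 i)].

Definition act (N : nat) (a : action N) (c : memory N) : memory N :=
  (fun i p => if p == c.2 i then a.1 i else c.1 i p,
   fun i => c.2 i + shift (a.2 i)).

Inductive prog (N : nat) :=
| Act of (reads N -> action N)
| Seq of prog N & prog N
| While of pred (reads N) & prog N.

(** The extra state [None] of a loop is the one in which its guard is tested; each test costs one
    step. *)
Fixpoint pstate (N : nat) (p : prog N) : finType :=
  match p with
  | Act _ => unit
  | Seq p q => (pstate p + pstate q)%type
  | While _ p => option (pstate p)
  end.

Fixpoint pstart (N : nat) (p : prog N) : pstate p :=
  match p with
  | Act _ => tt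
  | Seq p q => inl (pstart p)
  | While _ _ => None
  end.

(* The next state None means that the program exits. *)
Fixpoint pnext (N : nat) (p : prog N) (r : reads N) :
    pstate p -> option (pstate p) * action N :=
  match p with
  | Act a => fun _ => (None, a r)
  | Seq p q => fun x => match x with
      | inl x => let y := pnext r x in
          (Some (if y.1 is Some x' then inl x' else inr (pstart q)), y.2)
      | inr x => let y := pnext r x in (omap inr y.1, y.2)
      end
  | While b p => fun x => match x with
      | None => (if b r then Some (Some (pstart p)) else None,
                 (fun i => r i, fun=> Stay))
      | Some x => let y := pnext r x in (Some y.1, y.2)
      end
  end.

Definition pstep (N : nat) (p : prog N)
    (x : option (pstate p) * memory N) : option (pstate p) * memory N :=
  if x.1 is Some q then
    let y := pnext (scan x.2) q in (y.1, act y.2 x.2)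
  else x.

Definition machine (N : nat) (p : prog N) : turing_machine :=
  @TuringMachine unit (option (pstate p)) N (Some (pstart p))
    (fun q => ~~ isSome q)
    (fun q r => if q is Some q then (pnext r q).1 else None)
    (fun q r => if q is Some q then (pnext r q).2.1 else fun i => r i)
    (fun q r => if q is Some q then (pnext r q).2.2 else fun=> Stay).

(** Big-step semantics. By [exec_le] the last index is only an upper bound on the running time, so
    costs may be rounded up. *)
Inductive exec (N : nat) : prog N -> memory N -> memory N -> nat -> Prop :=
| exec_act a c : exec (Act a) c (act (a (scan c)) c) 1
| exec_seq p q c1 c2 c3 t1 t2 :
    exec p c1 c2 t1 -> exec q c2 c3 t2 -> exec (Seq p q) c1 c3 (t1 + t2)
| exec_while_stop (b : pred (reads N)) p c : ~~ b (scan c) -> exec (While b p) c c 1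
| exec_while_loop (b : pred (reads N)) p c1 c2 c3 t1 t2 :
    b (scan c1) -> exec p c1 c2 t1 -> exec (While b p) c2 c3 t2 ->
    exec (While b p) c1 c3 (t1 + t2).+1
| exec_le p c1 c2 t t' : (t <= t')%N -> exec p c1 c2 t -> exec p c1 c2 t'.

Lemma act_stay (N : nat) (c : memory N) :
  act (fun i => scan c i, fun=> Stay) c = c.
Proof.
case: c => T H; rewrite /act /=; congr pair.
  apply: functional_extensionality => i; apply: functional_extensionality => p.
  by rewrite ffunE /=; case: eqP => [->|].
by apply: functional_extensionality => i; rewrite addr0.
Qed.

Lemma pstep_some (N : nat) (p : prog N) (x : pstate p) c :
  pstep (Some x, c) =
  ((pnext (scan c) x).1, act (pnext (scan c) x).2 c).
Proof. by []. Qed.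

Lemma iter_pstep_none (N : nat) (p : prog N) t c :
  iter t (@pstep N p) (None, c) = (None, c).
Proof. by elim: t => //= t ->. Qed.

(** Both programs move in lockstep until [p] exits; from then on [p] alone would idle, hence the
    possibly smaller [t']. *)
Lemma iter_pstep_seql (N : nat) (p q : prog N) t x c c' :
  iter t (@pstep N p) (Some x, c) = (None, c') ->
  exists2 t', (t' <= t)%N &
    iter t' (@pstep N (Seq p q)) (Some (inl x), c) = (Some (inr (pstart q)), c').
Proof.
elim: t x c => [|t IH] x c //.
rewrite iterSr pstep_some.
case E: (pnext (scan c) x) => [[x'|] a] /=.
  move=> /IH [t' le_t' e]; exists t'.+1 => //.
  by rewrite iterSr pstep_some /= E.
rewrite iter_pstep_none => -[<-]; exists 1%N => //.
by rewrite /= pstep_some /= E.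
Qed.

Lemma iter_pstep_seqr (N : nat) (p q : prog N) t x c :
  iter t (@pstep N (Seq p q)) (omap inr x, c) =
  (omap inr (iter t (@pstep N q) (x, c)).1, (iter t (@pstep N q) (x, c)).2).
Proof.
elim: t => //= t ->; case: (iter _ _ _) => [[y|] c'] //=.
Qed.

Lemma iter_pstep_while (N : nat) b (p : prog N) t x c c' :
  iter t (@pstep N p) (Some x, c) = (None, c') ->
  exists2 t', (t' <= t)%N &
    iter t' (@pstep N (While b p)) (Some (Some x), c) = (Some None, c').
Proof.
elim: t x c => [|t IH] x c //.
rewrite iterSr pstep_some.
case E: (pnext (scan c) x) => [[x'|] a] /=.
  move=> /IH [t' le_t' e]; exists t'.+1 => //.
  by rewrite iterSr pstep_some /= E.
rewrite iter_pstep_none => -[<-]; exists 1%N => //.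
by rewrite /= pstep_some /= E.
Qed.

(** Correctness of the compilation, by induction on the derivation: the runs of the subprograms are
    glued together, and a guard test leaves the memory alone by [act_stay]. *)
Lemma exec_sound (N : nat) (p : prog N) c c' t : exec p c c' t ->
  exists2 t', (t' <= t)%N &
    iter t' (@pstep N p) (Some (pstart p), c) = (None, c').
Proof.
elim=> {p c c' t}.
- by move=> a c; exists 1%N.
- move=> p q c1 c2 c3 t1 t2 _ [u1 le1 e1] _ [u2 le2 e2].
  have [v1 le_v1 f1] := iter_pstep_seql q e1.
  exists (u2 + v1)%N; first lia.
  by rewrite iterD f1 (iter_pstep_seqr _ _ (Some _)) e2.
- move=> b p c hb; exists 1%N => //=.
  by rewrite pstep_some /= (negbTE hb) act_stay.
- move=> b p c1 c2 c3 t1 t2 hb _ [u1 le1 e1] _ [u2 le2 e2].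
  have [v1 le_v1 f1] := iter_pstep_while b e1.
  exists (u2 + v1).+1; first lia.
  by rewrite iterSr pstep_some /= hb act_stay iterD f1.
- move=> p c1 c2 t t' le_t _ [u le_u e].
  by exists u => //; apply: leq_trans le_t.
Qed.

Definition config_of (N : nat) (p : prog N)
    (x : option (pstate p) * memory N) : config (machine p) :=
  @Config (machine p) x.1 x.2.1 x.2.2.

Lemma iter_step_machine (N : nat) (p : prog N) t x :
  iter t (@step (machine p)) (config_of x) = config_of (iter t (@pstep N p) x).
Proof.
elim: t => //= t ->; case: (iter t _ x) => [[y|] c] //.
Qed.

Definition start_memory (N n : nat) : memory N :=
  (fun i => if i == ord0 then word_tape unit (binary n) else fun=> None,
   fun=> 0).

Lemma exec_computes_within (N : nat) (p : prog N) n m c T :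
  exec p (start_memory N n) c T ->
  (forall j, (j <= size (binary m))%N ->
     c.1 ord_max (c.2 ord_max + j%:Z) = word_tape unit (binary m) j%:Z) ->
  computes_within (machine p) n m T.
Proof.
move=> /exec_sound [t le_t e] out; exists t.
have -> : init (machine p) n = config_of (Some (pstart p), start_memory N n).
  by [].
by rewrite iter_step_machine e.
Qed.

(** * Registers *)

Definition marker_tape (p : int) : symbol unit :=
  if p == 0 then Some (inr tt) else None.

(** Input on the first tape, output on the last, integer registers in between. Heads are indexed by
    [nat] to keep ordinals out of register arithmetic. *)
Definition layout (N : nat) (inp : int -> symbol unit) (h : nat -> int)
    (o : int -> symbol unit) : memory N :=
  (fun (i : 'I_N.+1) p => if i == ord0 then inp p else
                         if i == ord_max then o p else marker_tape p,
   fun i : 'I_N.+1 => h i).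

Definition io_action (N : nat) (g : reads N -> symbol unit)
    (f : reads N -> nat -> move) (r : reads N) : action N :=
  (fun i : 'I_N.+1 => if i == ord_max then g r else r i,
   fun i : 'I_N.+1 => f r i).

Definition Io (N : nat) (g : reads N -> symbol unit)
    (f : reads N -> nat -> move) : prog N := Act (io_action g f).

(** Every tape but the last gets its scanned symbol written back, so input and marks survive;
    [0 < N] keeps the input and output tapes apart. *)
Lemma exec_Io (N : nat) inp h o g f : (0 < N)%N ->
  exec (@Io N g f) (layout N inp h o)
    (layout N inp (fun i => h i + shift (f (scan (layout N inp h o)) i))
       (fun p => if p == h N then g (scan (layout N inp h o)) else o p)) 1.
Proof.
move=> N_gt0; set c' := (X in exec _ _ X _).
suff -> : c' = act (io_action g f (scan (layout N inp h o))) (layout N inp h o).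
  exact: exec_act.
congr pair; apply: functional_extensionality => i.
apply: functional_extensionality => p /=; rewrite ffunE /=.
case: (altP (i =P ord0)) => [->|i0].
  have /negbTE -> : ord0 != ord_max :> 'I_N.+1 by rewrite -val_eqE /=; lia.
  by case: eqP => [->|].
by case: (altP (i =P ord_max)) => [->|im] //=; case: eqP => [->|].
Qed.

Lemma scan_layout0 (N : nat) inp h o : scan (layout N inp h o) ord0 = inp (h 0%N).
Proof. by rewrite ffunE. Qed.

Lemma scan_layout_max (N : nat) inp h o : (0 < N)%N ->
  scan (layout N inp h o) ord_max = o (h N).
Proof.
move=> N_gt0; rewrite ffunE /=.
have /negbTE -> : ord_max != ord0 :> 'I_N.+1 by rewrite -val_eqE /=; lia.
by rewrite eqxx.
Qed.

Lemma exec_Io_keep (N : nat) inp h o f : (0 < N)%N ->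
  exec (@Io N (fun r => r ord_max) f) (layout N inp h o)
    (layout N inp (fun i => h i + shift (f (scan (layout N inp h o)) i)) o) 1.
Proof.
move=> N_gt0.
have := exec_Io inp h o (fun r => r ord_max) f N_gt0.
set o' := (fun p : int => _); have -> // : o' = o.
apply: functional_extensionality => p; rewrite /o' scan_layout_max //.
by case: eqP => [->|].
Qed.

Definition Mv (N : nat) (f : nat -> move) : prog N :=
  Io (fun r => r ord_max) (fun=> f).

(** Loop-free register code translates the heads by a fixed vector [u], whatever the memory; under
    sequencing such vectors add up. *)
Definition adds (N : nat) (p : prog N) (u : nat -> int) (T : nat) :=
  forall inp h o, exec p (layout N inp h o) (layout N inp (fun i => h i + u i) o) T.

Lemma adds_Mv (N : nat) f : (0 < N)%N ->
  adds (Mv N f) (fun i => shift (f i)) 1.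
Proof. by move=> N_gt0 inp h o; apply: exec_Io_keep. Qed.

Lemma adds_ext (N : nat) (p : prog N) u v T : u =1 v -> adds p u T -> adds p v T.
Proof. by move=> /functional_extensionality ->. Qed.

Lemma adds_Seq (N : nat) (p q : prog N) u v T1 T2 :
  adds p u T1 -> adds q v T2 ->
  adds (Seq p q) (fun i => u i + v i) (T1 + T2).
Proof.
move=> hp hq inp h o; apply: exec_seq (hp inp h o) _.
have -> : (fun i => h i + (u i + v i)) = (fun i => h i + u i + v i).
  by apply: functional_extensionality => i; rewrite addrA.
exact: hq.
Qed.

Fixpoint rep (N : nat) (k : nat) (p : prog N) : prog N :=
  if k is k'.+1 then Seq p (rep k' p) else Mv N (fun=> Stay).

Lemma adds_rep (N : nat) k (p : prog N) u T : (0 < N)%N -> adds p u T ->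
  adds (rep k p) (fun i => k%:Z * u i) (k * T).+1.
Proof.
move=> N_gt0 hp; elim: k => [|k IH] /=.
  by apply: adds_ext (adds_Mv _ N_gt0) => i; rewrite mul0r.
rewrite mulSn -addnS.
by apply: adds_ext (adds_Seq hp IH) => i; rewrite intS mulrDl mul1r.
Qed.

Definition addv (N i : nat) (c : int) : prog N :=
  rep `|c| (Mv N (fun j => if j == i then if 0 <= c then MoveR else MoveL
                           else Stay)).

Lemma adds_addv (N i : nat) c : (0 < N)%N ->
  adds (addv N i c) (fun j => if j == i then c else 0) `|c|.+1.
Proof.
move=> N_gt0; rewrite -[`|c|%N]muln1.
apply: adds_ext (adds_rep _ N_gt0 (adds_Mv _ N_gt0)) => j /=.
by case: eqP => _; [case: (lerP 0 c) => hc /=; lia | rewrite mulr0].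
Qed.

Definition nz (N i : nat) : pred (reads N) :=
  fun r => r (inord i) != Some (inr tt).

Lemma nz_layout (N i : nat) inp h o : (0 < i < N)%N ->
  nz i (scan (layout N inp h o)) = (h i != 0).
Proof.
move=> /andP [i_gt0 iN]; rewrite /nz ffunE /=.
have e : val (inord i : 'I_N.+1) = i by rewrite /= inordK //; lia.
rewrite -!val_eqE /= e; have /negbTE -> : i != 0%N by lia.
have /negbTE -> : i != N by lia.
by rewrite /marker_tape; case: (h i =P 0).
Qed.

(** Each round lowers register [i] by [D], so from [k * D] its head meets the mark after exactly [k]
    rounds. Depending on [u], this moves a value, multiplies it by a constant or divides it exactly
    by [D]. *)
Lemma exec_drain (N : nat) (p : prog N) u T i (D k : nat) inp h o :
  adds p u T -> (0 < i < N)%N -> (0 < D)%N ->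
  u i = - D%:Z -> h i = (k * D)%:Z ->
  exec (While (@nz N i) p) (layout N inp h o)
    (layout N inp (fun j => h j + k%:Z * u j) o) (k * T.+1).+1.
Proof.
move=> hp hi D_gt0 ui; elim: k h => [|k IH] h hk.
  have -> : (fun j => h j + 0%:Z * u j) = h.
    by apply: functional_extensionality => j; rewrite mul0r addr0.
  by apply: exec_while_stop; rewrite nz_layout // hk.
have -> : (fun j => h j + k.+1%:Z * u j) = (fun j => h j + u j + k%:Z * u j).
  by apply: functional_extensionality => j; rewrite intS; ring.
apply: (@exec_le _ _ _ _ ((T + (k * T.+1).+1).+1)); first lia.
apply: exec_while_loop (hp inp h o) _.
  by rewrite nz_layout // hk; nia.
by apply: IH; rewrite hk ui mulSn PoszD; lia.
Qed.

(** * Program logic, input and output *)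

Definition assertion : Type := (nat -> int) -> (int -> symbol unit) -> Prop.

(** A total-correctness Hoare triple with a time bound; the contents of the input tape are a fixed
    parameter. *)
Definition triple (N : nat) (inp : int -> symbol unit) (P : assertion)
    (p : prog N) (Q : assertion) (T : nat) : Prop :=
  forall h o, P h o -> exists h' o',
    exec p (layout N inp h o) (layout N inp h' o') T /\ Q h' o'.

Lemma triple_seq (N : nat) inp P R Q (p q : prog N) T1 T2 :
  triple inp P p R T1 -> triple inp R q Q T2 ->
  triple inp P (Seq p q) Q (T1 + T2).
Proof.
move=> hp hq h o /hp [h1 [o1 [e1 /hq [h2 [o2 [e2 q2]]]]]].
by exists h2, o2; split=> //; apply: exec_seq e1 e2.
Qed.

(** The invariant is indexed by the number of rounds done, and the guard holds exactly while this
    number is below [k]; termination comes along with correctness. *)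
Lemma triple_while (N : nat) inp (I : nat -> assertion) b (p : prog N) k T :
  (forall j, (j < k)%N -> triple inp (I j) p (I j.+1) T) ->
  (forall j h o, (j <= k)%N -> I j h o ->
     b (scan (layout N inp h o)) = (j < k)%N) ->
  triple inp (I 0%N) (While b p) (I k) (k * T.+1).+1.
Proof.
elim: k I => [|k IH] I hp hb h o hI.
  by exists h, o; split=> //; apply: exec_while_stop; rewrite (hb 0%N).
have [h1 [o1 [e1 hI1]]] := hp 0%N isT h o hI.
have [||h2 [o2 [e2 hI2]]] := IH (fun j => I j.+1) _ _ h1 o1 hI1.
- by move=> j; apply: (hp j.+1).
- by move=> j; apply: (hb j.+1).
exists h2, o2; split=> //.
apply: (@exec_le _ _ _ _ ((T + (k * T.+1).+1).+1)); first lia.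
by apply: exec_while_loop e1 e2; rewrite (hb 0%N).
Qed.

Fixpoint seqs (N : nat) (f : nat -> prog N) (k : nat) : prog N :=
  if k is k'.+1 then Seq (seqs f k') (f k') else Mv N (fun=> Stay).

Lemma exec_skip (N : nat) inp h o : (0 < N)%N ->
  exec (Mv N (fun=> Stay)) (layout N inp h o) (layout N inp h o) 1.
Proof.
move=> N_gt0; have := adds_Mv (fun=> Stay) N_gt0 inp h o.
set h' := (X in exec _ _ (layout _ _ X _) _); have -> // : h' = h.
by apply: functional_extensionality => i; rewrite /h' addr0.
Qed.

Lemma triple_seqs (N : nat) inp (I : nat -> assertion) (f : nat -> prog N) k T :
  (0 < N)%N ->
  (forall j, (j < k)%N -> triple inp (I j) (f j) (I j.+1) T) ->
  triple inp (I 0%N) (seqs f k) (I k) (k * T).+1.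
Proof.
move=> N_gt0; elim: k => [|k IH] hf /=.
  by move=> h o hI; exists h, o; split=> //; apply: exec_skip.
have -> : (k.+1 * T).+1 = ((k * T).+1 + T)%N by lia.
apply: triple_seq (hf k (ltnSn k)); apply: IH => j lt_j.
by apply: hf; lia.
Qed.

(** * Binary words: reading the input and writing the output *)

Lemma size_binary n : size (binary n) = (trunc_log 2 n).+1.
Proof. by rewrite size_map size_rev size_iota. Qed.

Lemma word_tape_binary n j : (j <= trunc_log 2 n)%N ->
  word_tape unit (binary n) j%:Z =
  Some (inl (odd (n %/ 2 ^ (trunc_log 2 n - j)))).
Proof.
move=> le_j; rewrite /= (nth_map false) ?size_binary // (nth_map 0%N).
  by rewrite nth_rev ?size_iota // nth_iota ?add0n ?subSS //; lia.
by rewrite size_rev size_iota.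
Qed.

Lemma word_tape_binary_size n :
  word_tape unit (binary n) (trunc_log 2 n).+1%:Z = None.
Proof. by rewrite /= nth_default // size_map size_binary. Qed.

Lemma trunc_log2_le n : (trunc_log 2 n <= n)%N.
Proof.
case: (posnP n) => [->|n_gt0]; first by rewrite trunc_log0.
have := @trunc_logP 2 n isT n_gt0; have := @ltn_expl 2 (trunc_log 2 n) isT; lia.
Qed.

(** Horner's step: the quotients of [n] by decreasing powers of 2 are the values of the prefixes of
    its binary word. *)
Lemma divn_pow2_pred n k : (0 < k)%N ->
  (n %/ 2 ^ k.-1 = 2 * (n %/ 2 ^ k) + odd (n %/ 2 ^ k.-1))%N.
Proof.
case: k => //= k _; rewrite expnSr divnMA.
by rewrite mulnC -modn2 -divn_eq.
Qed.

Lemma adds_transfer (N i j : nat) c e : (0 < N)%N ->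
  adds (Seq (addv N i c) (addv N j e))
    (fun l => (if l == i then c else 0) + (if l == j then e else 0))
    (`|c|.+1 + `|e|.+1).
Proof. by move=> N_gt0; apply: adds_Seq; apply: adds_addv. Qed.

(* Horner's rule on the digits of the input, most significant first. *)
Definition read_input (N a b : nat) : prog N :=
  While (fun r : reads N => r ord0 != None)
    (Seq (While (@nz N a) (Seq (addv N a (-1)) (addv N b 2)))
    (Seq (While (@nz N b) (Seq (addv N b (-1)) (addv N a 1)))
         (Io (fun r => r ord_max)
             (fun r i => if (i == 0%N) ||
                            (i == a) && (r ord0 == Some (inl true))
                         then MoveR else Stay)))).

Lemma triple_read_input (N a b n : nat) h0 o0 :
  (0 < a < N)%N -> (0 < b < N)%N -> a != b ->
  h0 0%N = 0 -> h0 a = 0 -> h0 b = 0 ->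
  triple (word_tape unit (binary n)) (fun h o => h = h0 /\ o = o0)
    (read_input N a b)
    (fun h o => [/\ h a = n%:Z, o = o0 &
       forall i, i != 0%N -> i != a -> h i = h0 i])
    (n.+1 * (16 * n + 4)).+1.
Proof.
move=> ha hb ab h00 h0a h0b.
set L := trunc_log 2 n; have N_gt0 : (0 < N)%N by lia.
(* After [p] of the [L.+1] digits, [a] holds the value of the prefix read so far; for [p = 0] this
   is 0 because [n < 2 ^ L.+1]. *)
pose I p (h : nat -> int) (o : int -> symbol unit) :=
  [/\ h 0%N = p%:Z, h a = (n %/ 2 ^ (L.+1 - p))%:Z, o = o0 &
      forall i, i != 0%N -> i != a -> h i = h0 i].
have hI0 : I 0%N h0 o0.
  by split=> //; rewrite h0a subn0 divn_small // trunc_log_ltn.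
have hbody j : (j < L.+1)%N -> triple (word_tape unit (binary n)) (I j)
    (Seq (While (@nz N a) (Seq (addv N a (-1)) (addv N b 2)))
    (Seq (While (@nz N b) (Seq (addv N b (-1)) (addv N a 1)))
         (Io (fun r => r ord_max)
             (fun r i => if (i == 0%N) ||
                            (i == a) && (r ord0 == Some (inl true))
                         then MoveR else Stay)))) (I j.+1) (16 * n + 3).
  move=> lt_j h o [e0 ea eo ei].
  set V := (n %/ 2 ^ (L.+1 - j))%N in ea.
  have V_le : (V <= n)%N by apply: leq_div.
  have hbv : h b = 0 by rewrite ei; lia.
  (* Draining [a] into [b] with weight 2 doubles the value; draining [b] back leaves the scratch
     register [b] empty again. *)
  have E1 := @exec_drain N _ _ _ a 1 V (word_tape unit (binary n)) h o
    (adds_transfer a b (-1) 2 N_gt0) ha isT.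
  have {}E1 := E1 ltac:(by rewrite eqxx (negbTE ab)) ltac:(by rewrite muln1).
  set h1 := (X in exec _ _ (layout _ _ X _) _) in E1.
  have E2 := @exec_drain N _ _ _ b 1 (2 * V) (word_tape unit (binary n)) h1 o
    (adds_transfer b a (-1) 1 N_gt0) hb isT.
  have {}E2 := E2 ltac:(by rewrite eqxx eq_sym (negbTE ab))
    ltac:(by rewrite /h1 hbv eqxx eq_sym (negbTE ab); lia).
  set h2 := (X in exec _ _ (layout _ _ X _) _) in E2.
  have h20 : h2 0%N = j%:Z.
    rewrite /h2 /h1 e0; have /negbTE -> : 0%N != a by lia.
    have /negbTE -> : 0%N != b by lia.
    by rewrite !addr0 !mulr0 !addr0.
  have h2a : h2 a = (2 * V)%:Z.
    by rewrite /h2 /h1 ea eqxx (negbTE ab); lia.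
  have h2i i : i != 0%N -> i != a -> h2 i = h0 i.
    move=> i0 ia; rewrite /h2 /h1 ei // (negbTE ia).
    by case: eqP => _; lia.
  have E3 := exec_Io_keep (word_tape unit (binary n)) h2 o
    (fun r i => if (i == 0%N) || (i == a) && (r ord0 == Some (inl true))
                then MoveR else Stay) N_gt0.
  set h3 := (X in exec _ _ (layout _ _ X _) _) in E3.
  exists h3, o; split.
    apply: exec_le (exec_seq E1 (exec_seq E2 E3)); rewrite /=; lia.
  split=> //.
  - by rewrite /h3 h20 /=; lia.
  - rewrite /h3 h2a scan_layout0 h20 eqxx word_tape_binary //.
    have /negbTE -> : a != 0%N by lia.
    have -> : (L.+1 - j.+1 = (L.+1 - j).-1)%N by lia.
    rewrite (@divn_pow2_pred n (L.+1 - j)) ?subn_gt0 //.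
    have -> : (L.+1 - j).-1 = (L - j)%N by lia.
    by rewrite -/V; case: (odd _) => /=; lia.
  - by move=> i i0 ia; rewrite /h3 h2i // (negbTE i0) (negbTE ia) /= addr0.
have htest j h o : (j <= L.+1)%N -> I j h o ->
    (scan (layout N (word_tape unit (binary n)) h o) ord0 != None) = (j < L.+1)%N.
  move=> le_j [e0 _ _ _]; rewrite scan_layout0 e0.
  case: (ltnP j L.+1) => lt_j; first by rewrite word_tape_binary.
  by have -> : j = L.+1; [lia | rewrite word_tape_binary_size].
have := @triple_while N _ I (fun r => r ord0 != None) _ _ _ hbody htest.
move=> H h o [-> ->]; have [h' [o' [e [_ ea eo ei]]]] := H h0 o0 hI0.
exists h', o'; split.
  (* The number of digits [L.+1] is at most [n.+1]. *)
  apply: exec_le e; have := trunc_log2_le n; rewrite -/L; nia.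
by split=> //; rewrite ea subnn divn1.
Qed.

(** Each decrement of [v] flips the parity bit in the current output cell, and each flip from 1 to 0
    adds 1 to [w]. The bit ends as the last digit of [v], and [w] as the half of [v], which is moved
    back before the output head steps left. *)
Definition digit_loop (N v w : nat) : prog N :=
  Seq (Io (fun=> Some (inl false)) (fun _ _ => Stay))
  (Seq (While (@nz N v)
     (Io (fun r => Some (inl (r ord_max != Some (inl true))))
         (fun r i => if i == v then MoveL else
            if (i == w) && (r ord_max == Some (inl true)) then MoveR
            else Stay)))
  (Seq (While (@nz N w) (Seq (addv N w (-1)) (addv N v 1)))
       (Mv N (fun i => if i == N then MoveL else Stay)))).

(* Repeated halving of register v, writing the digits from right to left; the
   current cell of the output tape doubles as the parity bit. *)
Definition write_output (N v w : nat) : prog N :=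
  Seq (digit_loop N v w)
  (Seq (While (@nz N v) (digit_loop N v w))
       (Mv N (fun i => if i == N then MoveR else Stay))).

(** After [j] digits, the digit of weight [2 ^ i] sits in cell [-i]; the blank in cell 1 will end
    the output word. *)
Definition written (N v w m j : nat) : assertion := fun h o =>
  [/\ h v = (m %/ 2 ^ j)%:Z, h w = 0, h N = - j%:Z,
      forall i, (i < j)%N -> o (- i%:Z) = Some (inl (odd (m %/ 2 ^ i))) &
      o 1 = None].

Lemma triple_digit_loop (N v w m j : nat) inp :
  (0 < v < N)%N -> (0 < w < N)%N -> v != w ->
  triple inp (written N v w m j) (digit_loop N v w) (written N v w m j.+1)
    (7 * m + 4).
Proof.
move=> hv hw vw h o [ev ew eN eo e1]; have N_gt0 : (0 < N)%N by lia.
set V := (m %/ 2 ^ j)%N in ev; have V_le : (V <= m)%N by apply: leq_div.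
have vN : v != N by lia. have wN : w != N by lia.
have E0 := exec_Io inp h o (fun=> Some (inl false)) (fun _ _ => Stay) N_gt0.
set h1 := (X in exec _ _ (layout _ _ X _) _) in E0; set o1 := (X in exec _ _ (layout _ _ _ X) _) in E0.
pose K k (h : nat -> int) (o : int -> symbol unit) :=
  [/\ h v = (V - k)%:Z, h w = (k %/ 2)%:Z, h N = - j%:Z,
      forall i, (i < j)%N -> o (- i%:Z) = Some (inl (odd (m %/ 2 ^ i))) &
      o (- j%:Z) = Some (inl (odd k)) /\ o 1 = None].
have K0 : K 0%N h1 o1.
  rewrite /K /h1 /o1 /= !addr0 ev ew eN subn0 div0n; split=> //.
    by move=> i lt_i; rewrite eqr_opp eqz_nat (ltn_eqF lt_i); apply: eo.
  by rewrite eqxx; have /negbTE -> : 1 != - j%:Z by lia.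
have hstep k : (k < V)%N -> triple inp (K k)
     (Io (fun r : reads N => Some (inl (r ord_max != Some (inl true))))
         (fun r i => if i == v then MoveL else
            if (i == w) && (r ord_max == Some (inl true)) then MoveR
            else Stay)) (K k.+1) 1.
  move=> lt_k h' o' [fv fw fN fo [fj f1]].
  do 2!eexists; split; first exact: exec_Io.
  rewrite /K scan_layout_max // fN fj fv fw !eqxx.
  have -> : (w == v) = false by rewrite eq_sym (negbTE vw).
  have -> : (N == v) = false by lia.
  have -> : (N == w) = false by lia.
  split=> /=.
  - lia.
  - by case E: (odd k) => /=; lia.
  - by rewrite addr0.
  - by move=> i lt_i; rewrite eqr_opp eqz_nat (ltn_eqF lt_i); apply: fo.
  - have /negbTE -> : 1 != - j%:Z by lia.
    by split=> //; case: (odd k).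
have htest k h' o' : (k <= V)%N -> K k h' o' ->
    nz v (scan (layout N inp h' o')) = (k < V)%N.
  by move=> le_k [fv _ _ _ _]; rewrite nz_layout // fv; lia.
have [h2 [o2 [E1 [fv fw fN fo [fj f1]]]]] := triple_while hstep htest K0.
have E2 := @exec_drain N _ _ _ w 1 (V %/ 2) inp h2 o2
  (adds_transfer w v (-1) 1 N_gt0) hw isT.
have {}E2 := E2 ltac:(by rewrite eqxx eq_sym (negbTE vw))
  ltac:(by rewrite muln1).
set h3 := (X in exec _ _ (layout _ _ X _) _) in E2.
have E3 := adds_Mv (fun i => if i == N then MoveL else Stay) N_gt0 inp h3 o2.
set h4 := (X in exec _ _ (layout _ _ X _) _) in E3.
exists h4, o2; split.
  by apply: exec_le (exec_seq E0 (exec_seq E1 (exec_seq E2 E3))); rewrite /=; lia.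
rewrite /written /h4 /h3 fv fw fN eqxx (negbTE vN) (negbTE wN) (negbTE vw).
rewrite eq_sym (negbTE vw) !eqxx.
have -> : (N == v) = false by lia.
have -> : (N == w) = false by lia.
split=> //=.
- by rewrite expnSr divnMA -/V; lia.
- lia.
- lia.
- move=> i; rewrite ltnS leq_eqVlt => /orP [/eqP -> //|]; exact: fo.
Qed.

(** The last digit is written unconditionally, so that 0 gets its one digit; the guarded loop then
    writes the other [trunc_log 2 m] digits. *)
Lemma triple_write_output (N v w m : nat) inp :
  (0 < v < N)%N -> (0 < w < N)%N -> v != w ->
  triple inp (fun h o => [/\ h v = m%:Z, h w = 0, h N = 0 & o 1 = None])
    (write_output N v w)
    (fun h o => forall j, (j <= size (binary m))%N ->
       o (h N + j%:Z) = word_tape unit (binary m) j%:Z)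
    (m.+1 * (7 * m + 5) + 1).
Proof.
move=> hv hw vw h o [ev ew eN e1]; have N_gt0 : (0 < N)%N by lia.
have W0 : written N v w m 0 h o by split; rewrite ?divn1.
have [h1 [o1 [E1 W1]]] := triple_digit_loop inp hv hw vw W0.
pose I j := written N v w m j.+1; set L := trunc_log 2 m.
have hstep j : (j < L)%N ->
    triple inp (I j) (digit_loop N v w) (I j.+1) (7 * m + 4).
  by move=> _; apply: triple_digit_loop.
have htest j h' o' : (j <= L)%N -> I j h' o' ->
    nz v (scan (layout N inp h' o')) = (j < L)%N.
  move=> le_j [fv _ _ _ _]; rewrite nz_layout // fv.
  have [m0|m_gt0] := posnP m.
    by move: le_j; rewrite /L m0 trunc_log0 div0n; lia.
  case: (ltnP j L) => lt_j.
    have : (0 < m %/ 2 ^ j.+1)%N; last by lia.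
    rewrite divn_gt0 ?expn_gt0 //.
    by apply: leq_trans (@trunc_logP 2 m isT m_gt0); rewrite leq_exp2l.
  have -> : j = L by lia.
  by rewrite divn_small // trunc_log_ltn.
have [h2 [o2 [E2 [fv fw fN fo f1]]]] := triple_while hstep htest W1.
have E3 := adds_Mv (fun i => if i == N then MoveR else Stay) N_gt0 inp h2 o2.
set h3 := (X in exec _ _ (layout _ _ X _) _) in E3.
exists h3, o2; split.
  apply: exec_le (exec_seq E1 (exec_seq E2 E3)).
  have := trunc_log2_le m; rewrite -/L; nia.
(* The loop leaves the head one cell beyond the leading digit; the final move brings it back. *)
have -> : h3 N = - L%:Z by rewrite /h3 fN eqxx /=; lia.
move=> j; rewrite size_binary -/L leq_eqVlt => /orP [/eqP ->|lt_j].
  by rewrite word_tape_binary_size; have -> : - L%:Z + L.+1%:Z = 1 by lia.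
rewrite word_tape_binary //.
have -> : - L%:Z + j%:Z = - (L - j)%:Z by lia.
by apply: fo; lia.
Qed.

(** * The recurrence *)

(* Register j.+2 holds s (n + j), tape 1 collects the discarded values, tape
   d.+2 is an accumulator, tape d.+3 a loop counter and d.+4 the output. *)
Definition shift_pass (d : nat) (c : nat -> int) (j : nat) : prog d.+4 :=
  While (@nz d.+4 j.+2)
    (Seq (addv d.+4 j.+2 (-1))
    (Seq (addv d.+4 j.+1 1) (addv d.+4 d.+2 (c j)))).

(** Pass [j] adds [c j * s (n + j)] to the accumulator while moving [s (n + j)] down into the
    register emptied by the previous pass (tape 1 for the first). Register [d.+1] ends empty and
    receives the accumulator divided by [D]. *)
Definition recurrence_step (d D : nat) (c : nat -> int) : prog d.+4 :=
  Seq (seqs (shift_pass d c) d)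
    (While (@nz d.+4 d.+2)
       (Seq (addv d.+4 d.+2 (- D%:Z)) (addv d.+4 d.+1 1))).

Definition window (s : nat -> nat) (d n q : nat) : assertion := fun h o =>
  [/\ forall j, (j < d)%N -> h j.+2 = (s (n + j)%N)%:Z, h d.+2 = 0,
      h d.+3 = q%:Z, h d.+4 = 0 & o 1 = None].

(** In the time bound, [B] bounds the rounds of each loop, while [C + 6] and [D + 4] are the costs
    of one round of a pass and of the division, guard included. *)
Lemma triple_recurrence_step inp (s : nat -> nat) d D (c : nat -> int) C B n q :
  (0 < d)%N -> (0 < D)%N ->
  D%:Z * (s (n + d)%N)%:Z = \sum_(j < d) c j * (s (n + j)%N)%:Z ->
  (forall j, (j < d)%N -> `|c j| <= C)%N ->
  (forall j, (j <= d)%N -> s (n + j) <= B)%N ->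
  triple inp (window s d n q) (recurrence_step d D c) (window s d n.+1 q)
    ((d * (B * (C + 6)).+1).+1 + (B * (D + 4)).+1).
Proof.
move=> d_gt0 D_gt0 rec leC leB.
(* Before pass [k], the values [s (n + i)] with [0 < i < k] have moved down, those with [i >= k]
   have not, and for [k > 0] register [k.+1] in between is empty. *)
pose K k (h : nat -> int) (o : int -> symbol unit) :=
  [/\ forall j, (j.+1 < k)%N -> h j.+2 = (s (n + j.+1)%N)%:Z,
      forall j, (k <= j < d)%N -> h j.+2 = (s (n + j)%N)%:Z,
      (0 < k)%N -> h k.+1 = 0,
      h d.+2 = \sum_(j < k) c j * (s (n + j)%N)%:Z &
      [/\ h d.+3 = q%:Z, h d.+4 = 0 & o 1 = None]].
have hK k : (k < d)%N ->
    triple inp (K k) (shift_pass d c k) (K k.+1) (B * (C + 6)).+1.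
  move=> lt_k h o [h1 h2 h3 h4 [h5 h6 h7]].
  have hk : h k.+2 = (s (n + k)%N)%:Z by apply: h2; lia.
  have A := adds_Seq (adds_addv k.+2 (-1) (isT : 0 < d.+4)%N)
    (adds_Seq (adds_addv k.+1 1 (isT : 0 < d.+4)%N)
              (adds_addv d.+2 (c k) (isT : 0 < d.+4)%N)).
  set V := s (n + k)%N in hk.
  have ui : (if k.+2 == k.+2 then -1 else 0) +
      ((if k.+2 == k.+1 then 1 else 0) +
       (if k.+2 == d.+2 then c k else 0)) = - 1%:Z :> int.
    rewrite eqxx; have /negbTE -> : k.+2 != k.+1 by lia.
    by have /negbTE -> : k.+2 != d.+2 by lia.
  have hi : (0 < k.+2 < d.+4)%N by lia.
  have hv : h k.+2 = (V * 1)%:Z by rewrite muln1.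
  have E := exec_drain inp o A hi (isT : 0 < 1)%N ui hv.
  set h' := (X in exec _ _ (layout _ _ X _) _) in E.
  have far l : l != k.+2 -> l != k.+1 -> l != d.+2 -> h' l = h l.
    by rewrite /h' => /negbTE -> /negbTE -> /negbTE ->; lia.
  exists h', o; split.
    apply: exec_le E; have := leC k lt_k; have := leB k (ltnW lt_k).
    by rewrite -/V /=; nia.
  split.
  - move=> j; rewrite ltnS leq_eqVlt => /orP [/eqP ejk|lt_j]; last first.
      by rewrite far ?h1 //; lia.
    rewrite /h' ejk eqxx h3; last lia.
    have /negbTE -> : k.+1 != k.+2 by lia.
    have /negbTE -> : k.+1 != d.+2 by lia.
    by rewrite -/V; lia.
  - by move=> j hj; rewrite far ?h2 //; lia.
  - by move=> _; rewrite /h' ui hk; lia.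
  - rewrite big_ord_recr /= -h4 /h' eqxx -/V.
    have /negbTE -> : d.+2 != k.+2 by lia.
    have /negbTE -> : d.+2 != k.+1 by lia.
    by rewrite !add0r mulrC.
  - by rewrite !far //; lia.
have H := triple_seqs (isT : 0 < d.+4)%N hK.
move=> h o [w1 w2 w3 w4 w5].
have K0 : K 0%N h o by split=> //; rewrite ?big_ord0 // => j /w1.
have [h1 [o1 [E1 [k1 _ k3 k4 [k5 k6 k7]]]]] := H h o K0.
have ui : (if d.+2 == d.+2 then - D%:Z else 0) +
    (if d.+2 == d.+1 then 1 else 0) = - D%:Z :> int.
  by rewrite eqxx (_ : (d.+2 == d.+1) = false) ?addr0 //; lia.
have hi : (0 < d.+2 < d.+4)%N by lia.
(* Partial sums may be negative, but the full sum is exactly [D * s (n + d)], so the division loop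
   reaches zero after [s (n + d)] rounds. *)
have hv : h1 d.+2 = (s (n + d) * D)%:Z by rewrite k4 -rec PoszM mulrC.
have E2 := exec_drain inp o1
  (adds_transfer d.+2 d.+1 (- D%:Z) 1 (isT : 0 < d.+4)%N) hi D_gt0 ui hv.
set h2 := (X in exec _ _ (layout _ _ X _) _) in E2.
have far l : l != d.+2 -> l != d.+1 -> h2 l = h1 l.
  by rewrite /h2 => /negbTE -> /negbTE ->; lia.
exists h2, o1; split.
  apply: exec_le (exec_seq E1 E2); rewrite leq_add2l ltnS.
  by have := leB d (leqnn d); rewrite /=; nia.
split.
- move=> j lt_j; case: (ltnP j.+1 d) => lt_j1.
    by rewrite far ?k1 ?addSnnS //; lia.
  have ej : j.+2 = d.+1 by lia.
  rewrite /h2 ej eqxx k3 //; have /negbTE -> : d.+1 != d.+2 by lia.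
  have -> : (n.+1 + j = n + d)%N by lia.
  by rewrite !add0r mulr1.
- by rewrite /h2 ui hv PoszM; lia.
- by rewrite far //; lia.
- by rewrite far //; lia.
- by [].
Qed.

(** * The complete program and its running time *)

Definition mark_action (N : nat) (r : reads N) : action N :=
  (fun i : 'I_N.+1 =>
     if (i == ord0) || (i == ord_max) then r i else Some (inr tt),
   fun=> Stay).

(** The register tapes start blank with all heads at cell 0, so a single step sets every mark. *)
Lemma exec_mark (N n : nat) :
  exec (Act (@mark_action N)) (start_memory N n)
    (layout N (word_tape unit (binary n)) (fun=> 0) (fun=> None)) 1.
Proof.
set c := start_memory N n; set c' := layout _ _ _ _.
suff -> : c' = act (mark_action (scan c)) c by apply: exec_act.
rewrite /c' /layout /act /=; congr pair.
apply: functional_extensionality => i; apply: functional_extensionality => p.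
rewrite /= ffunE /marker_tape /=.
case: (altP (i =P ord0)) => [_|i0] /=; first by case: eqP => [->|].
by case: (altP (i =P ord_max)) => [_|im] /=; case: eqP.
Qed.

(** The initial values [s j] with [j < d] are constants of the program. The accumulator [d.+2],
    being zero at those moments, also serves as scratch register for input and output. *)
Definition sequence_prog (s : nat -> nat) (d D : nat) (c : nat -> int) :
    prog d.+4 :=
  Seq (Act (@mark_action d.+4))
  (Seq (read_input d.+4 d.+3 d.+2)
  (Seq (seqs (fun j => addv d.+4 j.+2 (s j)%:Z) d)
  (Seq (While (@nz d.+4 d.+3)
         (Seq (addv d.+4 d.+3 (-1)) (recurrence_step d D c)))
       (write_output d.+4 2 d.+2)))).

Lemma triple_load inp (s : nat -> nat) d B q :
  (forall j, (j < d)%N -> s j <= B)%N ->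
  triple inp (window (fun=> 0%N) d 0 q)
    (seqs (fun j => addv d.+4 j.+2 (s j)%:Z) d) (window s d 0 q)
    (d * B.+1).+1.
Proof.
move=> leB.
(* Cutting the sequence off after [k] terms interpolates between the zero window and that of [s]. *)
pose I k := window (fun j => if (j < k)%N then s j else 0%N) d 0 q.
have hI k : (k < d)%N ->
    triple inp (I k) (addv d.+4 k.+2 (s k)%:Z) (I k.+1) B.+1.
  move=> lt_k h o [h1 h2 h3 h4 h5].
  have E := adds_addv k.+2 (s k)%:Z (isT : 0 < d.+4)%N inp h o.
  set h' := (X in exec _ _ (layout _ _ X _) _) in E.
  have far l : l != k.+2 -> h' l = h l.
    by rewrite /h' => /negbTE ->; rewrite addr0.
  exists h', o; split; first by apply: exec_le E; rewrite ltnS leB.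
  split=> //; try by rewrite far //; lia.
  move=> j lt_j; rewrite add0n ltnS leq_eqVlt.
  have [->|ne_j] /= := eqVneq j k.
    by rewrite /h' eqxx h1 // add0n ltnn add0r.
  by rewrite far ?h1 //; lia.
have H := triple_seqs (isT : 0 < d.+4)%N hI.
move=> h o [h1 h2 h3 h4 h5].
have I0 : I 0%N h o by split.
have [h' [o' [E [k1 k2 k3 k4 k5]]]] := H h o I0; exists h', o'; split=> //.
by split=> // j lt_j; rewrite k1 // add0n lt_j.
Qed.

(** The five summands of the time bound belong to marking, reading, loading, the [n] recurrence
    steps and writing, in this order. *)
Lemma sequence_prog_computes (s : nat -> nat) d D (c : nat -> int) C B n :
  (0 < d)%N -> (0 < D)%N ->
  (forall i, D%:Z * (s (i + d)%N)%:Z = \sum_(j < d) c j * (s (i + j)%N)%:Z) ->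
  (forall j, (j < d)%N -> `|c j| <= C)%N ->
  (forall i, (i <= n + d)%N -> s i <= B)%N ->
  computes_within (machine (sequence_prog s d D c)) n (s n)
    (1 + ((n.+1 * (16 * n + 4)).+1 + ((d * B.+1).+1 +
     ((n * (2 + ((d * (B * (C + 6)).+1).+1 + (B * (D + 4)).+1)).+1).+1 +
      (B.+1 * (7 * B + 5) + 1))))).
Proof.
move=> d_gt0 D_gt0 rec leC leB; set inp := word_tape unit (binary n).
have sn_le : (s n <= B)%N by apply: leB; lia.
have E0 := exec_mark d.+4 n.
have [||||h1 [o1 [E1 [a1 a2 a3]]]] := @triple_read_input d.+4 d.+3 d.+2 n
  (fun=> 0) (fun=> None) _ _ _ erefl erefl erefl (fun=> 0) (fun=> None).
- lia.
- lia.
- lia.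
- by [].
have W1 : window (fun=> 0%N) d 0 n h1 o1.
  by split; rewrite ?a2 // => *; rewrite a3 //; lia.
have [|h2 [o2 [E2 W2]]] := @triple_load inp s d B n _ h1 o1 W1.
  by move=> j lt_j; apply: leB; lia.
pose I k := window s d k (n - k).
have hI k : (k < n)%N -> triple inp (I k)
    (Seq (addv d.+4 d.+3 (-1)) (recurrence_step d D c)) (I k.+1)
    (2 + ((d * (B * (C + 6)).+1).+1 + (B * (D + 4)).+1)).
  move=> lt_k; apply: (@triple_seq _ _ _ (window s d k (n - k.+1))).
    move=> h o [b1 b2 b3 b4 b5].
    have E := adds_addv d.+3 (-1) (isT : 0 < d.+4)%N inp h o.
    set h' := (X in exec _ _ (layout _ _ X _) _) in E.
    have far l : l != d.+3 -> h' l = h l.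
      by rewrite /h' => /negbTE ->; rewrite addr0.
    exists h', o; split=> //; split=> //; try by rewrite far //; lia.
      by move=> j lt_j; rewrite far ?b1 //; lia.
    by rewrite /h' eqxx b3; lia.
  apply: triple_recurrence_step => // j le_j; apply: leB; lia.
have htest k h o : (k <= n)%N -> I k h o ->
    nz d.+3 (scan (layout d.+4 inp h o)) = (k < n)%N.
  by move=> le_k [_ _ b3 _ _]; rewrite nz_layout ?b3; lia.
have W2' : I 0%N h2 o2 by rewrite /I subn0.
have [h3 [o3 [E3 [w1 w2 w3 w4 w5]]]] := triple_while hI htest W2'.
have [||||h4 [o4 [E4 out]]] :=
  @triple_write_output d.+4 2 d.+2 (s n) inp _ _ _ h3 o3.
- lia.
- lia.
- lia.
(* The window now starts at [n], so register 2 holds [s n]. *)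
- by split=> //; rewrite w1 // addn0.
apply: (exec_computes_within (c := layout d.+4 inp h4 o4)).
  apply: exec_le (exec_seq E0 (exec_seq E1 (exec_seq E2 (exec_seq E3 E4)))).
  by rewrite !leq_add2l leq_add2r; apply: leq_mul; lia.
move=> j /out <-; rewrite /layout /=.
by rewrite eqxx.
Qed.

(** * Elementary bounds *)

(** Closure of this class under sums, products and exponentials turns an explicit time bound into
    the one demanded by [kalmar]. *)
Definition elementary (f : nat -> nat) : Prop :=
  exists k, forall n, (f n <= tower k n)%N.

Lemma tower_le k l n : (k <= l)%N -> (tower k n <= tower l n)%N.
Proof.
move=> /subnK <-; elim: (l - k)%N => // m IH.
by rewrite addSn; apply: leq_trans IH (ltnW (ltn_expl _ _)).
Qed.

Lemma elementary2 f g : elementary f -> elementary g ->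
  exists k, forall n, (f n <= tower k n)%N /\ (g n <= tower k n)%N.
Proof.
move=> [k hk] [l hl]; exists (maxn k l) => n; split.
  exact: leq_trans (hk n) (tower_le _ (leq_maxl _ _)).
exact: leq_trans (hl n) (tower_le _ (leq_maxr _ _)).
Qed.

(** One exponential raises any value by at least 1, so [c] of them reach [c]. *)
Lemma elementary_const c : elementary (fun=> c).
Proof.
by exists c => n; elim: c => // c IH; apply: leq_ltn_trans IH (ltn_expl _ _).
Qed.

Lemma elementary_id : elementary id.
Proof. by exists 0%N. Qed.

Lemma muln2_le_expn2 x : (2 * x <= 2 ^ x)%N.
Proof.
case: x => // x; rewrite expnS leq_mul2l /=; exact: ltn_expl.
Qed.

Lemma sqrn_le_expn2 x : (x * x <= 2 ^ 2 ^ x)%N.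
Proof.
apply: leq_trans (_ : 2 ^ x * 2 ^ x <= _)%N.
  by apply: leq_mul; apply: ltnW (ltn_expl _ _).
by rewrite -expnD addnn -mul2n leq_exp2l // muln2_le_expn2.
Qed.

Lemma elementary_add f g : elementary f -> elementary g ->
  elementary (fun n => f n + g n)%N.
Proof.
move=> hf hg; have [k hk] := elementary2 hf hg; exists k.+1 => n.
apply: leq_trans (muln2_le_expn2 _); have [] := hk n.
by rewrite mul2n -addnn; apply: leq_add.
Qed.

Lemma elementary_mul f g : elementary f -> elementary g ->
  elementary (fun n => f n * g n)%N.
Proof.
move=> hf hg; have [k hk] := elementary2 hf hg; exists k.+2 => n.
by apply: leq_trans (sqrn_le_expn2 _); have [] := hk n; apply: leq_mul.
Qed.

(** As [c <= 2 ^ c], the power is at most [2 ^ (c * f n)], one exponential above the product. *)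
Lemma elementary_exp c f : elementary f -> elementary (fun n => c ^ f n)%N.
Proof.
move=> hf; have [k hk] := elementary_mul (elementary_const c) hf.
exists k.+1 => n; apply: leq_trans (_ : (2 ^ c) ^ f n <= _)%N.
  by case: (f n) => // m; rewrite leq_exp2r //; apply: ltnW (ltn_expl _ _).
by rewrite -expnM leq_exp2l.
Qed.

Lemma elementary_S f : elementary f -> elementary (fun n => (f n).+1).
Proof.
move=> hf; have [k hk] := elementary_add (elementary_const 1) hf.
by exists k.
Qed.

(** * Integer form of the recurrence and growth of its solutions *)

Lemma common_denominator (alpha : nat -> rat) d :
  exists2 D : nat, (0 < D)%N &
    forall i, (i <= d)%N -> exists z : int, D%:R * alpha i = z%:~R.
Proof.
have clear_den x : exists2 D : nat, (0 < D)%N &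
    exists z : int, D%:R * x = z%:~R :> rat.
  exists `|denq x|%N; first by rewrite absz_gt0 denq_neq0.
  exists (numq x); rewrite pmulrn gez0_abs ?denq_ge0 //.
  by rewrite mulrC -numqE.
elim: d => [|d [D D_gt0 hD]].
  by have [D D_gt0 hD] := clear_den (alpha 0%N); exists D => // -[].
have [E E_gt0 [z hz]] := clear_den (alpha d.+1).
exists (D * E)%N => [|i]; first by rewrite muln_gt0 D_gt0.
rewrite leq_eqVlt => /orP [/eqP ->|/hD [y hy]].
  by exists (D%:Z * z); rewrite natrM -mulrA hz intrM.
by exists (E%:Z * y); rewrite mulnC natrM -mulrA hy intrM.
Qed.

(** Multiplying by a common denominator and reversing the order of summation gives
    [c j = - D * alpha (d - j)]; [numq] reads this rational off as an integer. *)
Lemma C_recursive_int (s : nat -> nat) : C_recursive s ->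
  exists (d D : nat) (c : nat -> int), [/\ (0 < d)%N, (0 < D)%N &
    forall n, D%:Z * (s (n + d)%N)%:Z = \sum_(j < d) c j * (s (n + j)%N)%:Z].
Proof.
move=> [d [alpha [d_gt0 _ rec]]].
have [D D_gt0 hD] := common_denominator alpha d.
exists d, D, (fun j => - numq (D%:R * alpha (d - j)%N)); split=> // n.
have natE k : (k%:Z)%:~R = k%:R :> rat by [].
apply: (@intr_inj rat); rewrite rmorphM rmorph_sum /= !natE.
have /eqP := rec n; rewrite addr_eq0 => /eqP ->.
rewrite mulrN mulr_sumr big_add1 /= big_nat_rev /= big_mkord -sumrN.
apply: eq_bigr => j _; rewrite add0n rmorphM rmorphN /= mulNr; congr (- _).
have -> : (d - j.+1).+1 = (d - j)%N by have := ltn_ord j; lia.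
have -> : (n + d - (d - j) = n + j)%N by have := ltn_ord j; lia.
have [z hz] := hD (d - j)%N (leq_subr _ _).
by rewrite hz numq_int mulrA -hz.
Qed.

(** Since [D >= 1], dropping it and taking absolute values bounds [s (n + d)] by the sum of the
    [|c j| * s (n + j)]; strong induction does the rest. *)
Lemma recurrence_growth (s : nat -> nat) d D (c : nat -> int) :
  (0 < D)%N ->
  (forall n, D%:Z * (s (n + d)%N)%:Z = \sum_(j < d) c j * (s (n + j)%N)%:Z) ->
  exists2 C : nat, (0 < C)%N & forall n, (s n <= C ^ n.+1)%N.
Proof.
move=> D_gt0 rec; pose A := (\sum_(j < d) `|c j|)%N.
(* The 1 makes [C] positive, [A] pays for one recurrence step, and the last sum covers the initial
   values. *)
pose C := (1 + A + \sum_(j < d) s j)%N; exists C => //.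
elim/ltn_ind => n IH; case: (ltnP n d) => [lt_n|le_d].
  apply: leq_trans (_ : C <= _)%N.
    rewrite /C (bigD1 (Ordinal lt_n)) //=; lia.
  by rewrite expnS leq_pmulr // expn_gt0.
move: IH; rewrite -(subnK le_d); move: (n - d)%N => {le_d}{}n IH.
have le1 : (s (n + d) <= \sum_(j < d) `|c j| * s (n + j))%N.
  rewrite -lez_nat; apply: le_trans (_ : D%:Z * (s (n + d)%N)%:Z <= _).
    by rewrite -PoszM lez_nat leq_pmull.
  rewrite rec [leRHS](_ : _ = \sum_(j < d) (`|c j| * s (n + j)%N)%N%:Z).
    by apply: ler_sum => j _; rewrite PoszM ler_wpM2r // lez_abs.
  exact: (big_morph Posz PoszD erefl).
apply: leq_trans le1 _; rewrite expnS.
apply: leq_trans (_ : A * C ^ (n + d) <= _)%N; last first.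
  by apply: leq_mul => //; rewrite /C; lia.
rewrite /A big_distrl /=; apply: leq_sum => j _; apply: leq_mul => //.
have lt_j := ltn_ord j.
apply: leq_trans (IH (n + j)%N _) _; first by lia.
by apply: leq_pexp2l => //; lia.
Qed.

Theorem theorem5p3 (s : nat -> nat) : C_recursive s -> kalmar s.
Proof.
move=> /C_recursive_int [d [D [c [d_gt0 D_gt0 rec]]]].
have [A A_gt0 leA] := recurrence_growth D_gt0 rec.
(* [C] bounds each coefficient, and [B n] bounds [s i] for all [i <= n + d] because [A > 0] makes
   the powers nondecreasing. *)
pose C := (\sum_(j < d) `|c j|)%N; pose B n := (A ^ (n + d).+1)%N.
have elB : elementary B.
  apply: elementary_exp; apply: elementary_S; apply: elementary_add.
    exact: elementary_id.
  exact: elementary_const.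
(* The time bound of [sequence_prog_computes], built from constants, [n] and [B n] by sums, products
   and successors. *)
pose T n := (1 + ((n.+1 * (16 * n + 4)).+1 + ((d * (B n).+1).+1 +
     ((n * (2 + ((d * (B n * (C + 6)).+1).+1 + (B n * (D + 4)).+1)).+1).+1 +
      ((B n).+1 * (7 * B n + 5) + 1)))))%N.
have [k hk] : elementary T.
  by rewrite /T; repeat first [ exact: elementary_const | exact: elB
    | exact: elementary_id | apply: elementary_add | apply: elementary_mul
    | apply: elementary_S ].
exists k, (machine (sequence_prog s d D c)) => n.
have [|i le_i|t [le_t halts out]] :=
  @sequence_prog_computes s d D c C (B n) n d_gt0 D_gt0 rec.
- by move=> j lt_j; rewrite /C (bigD1 (Ordinal lt_j)) //= leq_addr.
- by apply: leq_trans (leA i) _; apply: leq_pexp2l => //; lia.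
by exists t; split=> //; apply: leq_trans le_t (hk n).
Qed.
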